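(* Let $d\ge1$, let $S$ be a non-empty finite set, and let $X$ and $X'$ be two ergodic $S$-valued Markov random fields on $\mathbb{Z}^d$ with distinct distributions and with the same specification. Suppose that, for some $\epsilon>0$, $$\inf_{T\subset\Omega_{\partial\Lambda_n}:\ \Pr(X'_{\partial\Lambda_n}\in T)\ge1-\epsilon}\ \Pr(X_{\partial\Lambda_n}\in T)\ \ge\ e^{-o(n^d)}\qquad\text{as }n\to\infty.$$ Then $X$ is not ffiid.
   Context: Lattice. $\mathbb{Z}^d$ is a graph in which $u,v$ are adjacent iff $\|u-v\|_1=1$; $\partial V$ is the set of vertices at graph distance exactly $1$ from $V$; $\mathbf 0$ is the origin; $\Lambda_n=[-n,n]^d\cap\mathbb{Z}^d$. Markov random fields. $X=(X_v)_{v\in\mathbb{Z}^d}$ takes values in the non-empty finite set $S$. It is a Markov random field if for every finite $V\subset\mathbb{Z}^d$, $(X_v)_{v\in V}$ and $(X_v)_{v\in V^c}$ are conditionally independent given $(X_v)_{v\in\partial V}$. It is translation-invariant if $(X_{v+u})_{v}$ has the same law as $X$ for every $u\in\mathbb{Z}^d$. It is ergodic if it is translation-invariant and every translation-invariant event (invariant under all translations of $\mathbb{Z}^d$) has probability $0$ or $1$. The topological support of $X$ is $\Omega=\{x\in S^{\mathbb{Z}^d}:\Pr(X_V=x_V)>0 \text{ for all finite }V\}$, where $x_V=(x_v)_{v\in V}$, and $\Omega_V=\{\omega_V:\omega\in\Omega\}$. The specification of $X$ is the family $P=(P_V^\tau)$ indexed by finite $V\subset\mathbb{Z}^d$ and $\tau\in\Omega_{\partial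 V}$, with $P_V^\tau=\Pr(X_V\in\cdot\mid X_{\partial V}=\tau)$. Having the same specification means that these indexed families (including their index sets) coincide. Codings. Let $Y=(Y_v)_{v\in\mathbb{Z}^d}$ be a translation-invariant random field with values in a measurable space $T$. A coding from $Y$ to $X$ is a measurable $\varphi:T^{\mathbb{Z}^d}\to S^{\mathbb{Z}^d}$ commuting with all translations of $\mathbb{Z}^d$ and such that $\varphi(Y)$ has the same distribution as $X$. Its coding radius $R_\varphi(y)$ at $y$ is the minimal integer $r\ge0$ such that $\varphi(y')_{\mathbf 0}=\varphi(y)_{\mathbf 0}$ for all $y'$ agreeing with $y$ on $\{v:\|v\|_1\le r\}$ ($\infty$ if none exists). The coding is finitary if $R_\varphi(Y)<\infty$ a.s. $X$ is ffiid if there is a finitary coding to $X$ from some i.i.d. process $Y=(Y_v)_{v\in\mathbb{Z}^d}$ taking values in some measurable space. *)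

(* Defs.v *)
From mathcomp Require Import all_boot all_order all_algebra finmap.
From mathcomp Require Import all_classical all_reals all_analysis.

Set Implicit Arguments.
Unset Strict Implicit.
Unset Printing Implicit Defensive.

Import Order.TTheory GRing.Theory Num.Theory.
Import numFieldNormedType.Exports.

Local Open Scope classical_set_scope.
Local Open Scope ring_scope.

Definition l1norm (d : nat) (v : 'rV[int]_d) : nat :=
  (\sum_(i < d) `|v ord0 i|)%N.

Definition adjacent (d : nat) (u v : 'rV[int]_d) : Prop := l1norm (u - v) = 1%N.

Definition l1ball (d r : nat) : set 'rV[int]_d :=
  [set v : 'rV[int]_d | (l1norm v <= r)%N].

Arguments l1ball d r _ : clear implicits.

Definition box (d n : nat) : set 'rV[int]_d :=
  [set v : 'rV[int]_d | forall i, (`|v ord0 i| <= n)%N].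

Arguments box d n _ : clear implicits.

(* A vertex is at graph distance exactly 1 from V iff it is not in V (distance
   0 is excluded) and is adjacent to some vertex of V. *)
Definition boundary (d : nat) (V : set 'rV[int]_d) : set 'rV[int]_d :=
  [set u | ~ V u /\ exists2 v, V v & adjacent u v].

Definition discrete (S : pointedType) :=
  g_sigma_algebraType (@discrete_measurable S).

Definition cylinders (d : nat) (dT : measure_display) (T : measurableType dT) :
    set_system ('rV[int]_d -> T) :=
  \bigcup_v preimage_set_system setT (fun x : 'rV[int]_d -> T => x v) measurable.

(* T^(Z^d) with its product sigma-algebra *)
Definition config (d : nat) (dT : measure_display) (T : measurableType dT) :=
  g_sigma_algebraType (@cylinders d dT T).

Definition shift (d : nat) (dT : measure_display) (T : measurableType dT)
    (u : 'rV[int]_d) (x : config d T) : config d T :=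
  fun v => x (v + u).

Section random_fields.
Context (d : nat) (R : realType).
Context (dO : measure_display) (O : measurableType dO) (P : probability O R).
Context (dT : measure_display) (T : measurableType dT).

Definition random_field := 'rV[int]_d -> {RV P >-> T}.

Definition sample (X : random_field) (w : O) : config d T := fun v => X v w.

Definition sigma_field (X : random_field) (V : set 'rV[int]_d) : set_system O :=
  <<s \bigcup_(v in V) preimage_set_system setT (X v) measurable >>.

Definition cond_prob (A C : set O) : R := fine (P (A `&` C)) / fine (P C).

Definition iid (X : random_field) : Prop :=
  (forall v A, measurable A -> distribution P (X v) A = distribution P (X 0) A)
  /\ (forall (V : {fset 'rV[int]_d}) (A : 'rV[int]_d -> set T),
        (forall v, measurable (A v)) ->
        P (\bigcap_(v in [set` V]) X v @^-1` A v) =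
        (\prod_(v <- V) P (X v @^-1` A v))%E).

End random_fields.

Definition same_law (d : nat) (dT : measure_display) (T : measurableType dT)
    (R : realType) (dO dO' : measure_display) (O : measurableType dO)
    (O' : measurableType dO') (P : probability O R) (f : O -> config d T)
    (P' : probability O' R) (f' : O' -> config d T) : Prop :=
  forall A : set (config d T), measurable A ->
    pushforward P f A = pushforward P' f' A.

Definition translation_invariant (d : nat) (R : realType) (dO : measure_display)
    (O : measurableType dO) (P : probability O R) (dT : measure_display)
    (T : measurableType dT) (X : random_field d P T) : Prop :=
  forall u, same_law P (shift u \o sample X) P (sample X).

Definition ergodic (d : nat) (R : realType) (dO : measure_display)
    (O : measurableType dO) (P : probability O R) (dT : measure_display)
    (T : measurableType dT) (X : random_field d P T) : Prop :=
  translation_invariant X /\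
  forall A : set (config d T), measurable A ->
    (forall u, shift u @^-1` A = A) ->
    P (sample X @^-1` A) = 0%E \/ P (sample X @^-1` A) = 1%E.

Section finite_valued.
Context (d : nat) (S : pointedType) (R : realType).
Context (dO : measure_display) (O : measurableType dO) (P : probability O R).
Implicit Types (X : random_field d P (discrete S)) (V : set 'rV[int]_d).

(* The event {X_V \in A}; a partial configuration on V is a function on the
   type of elements of V, and x_V is sigL V x. *)
Definition event X V (A : set (V -> S)) : set O :=
  [set w | A (sigL V (sample X w))].

(* With S and V finite, X_{boundary V} takes finitely many values, so
   conditioning on it is elementary conditioning on its atoms. *)
Definition markov_random_field X : Prop :=
  forall V, finite_set V ->
  forall tau : boundary V -> S, (0 < P (event X [set tau]))%E ->
  forall A B : set O, sigma_field X V A -> sigma_field X (~` V) B ->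
  let C := event X [set tau] in
  cond_prob P (A `&` B) C = cond_prob P A C * cond_prob P B C.

Definition support X : set ('rV[int]_d -> S) :=
  [set x | forall V, finite_set V -> (0 < P (event X [set sigL V x]))%E].

Definition support_on X V : set (V -> S) := sigL V @` support X.

Definition specification X V (tau : boundary V -> S) : set (V -> S) -> R :=
  fun A => cond_prob P (event X A) (event X [set tau]).

End finite_valued.

Arguments support_on {d S R dO O P} X V _.

Definition same_specification (d : nat) (S : pointedType) (R : realType)
    (dO dO' : measure_display) (O : measurableType dO) (O' : measurableType dO')
    (P : probability O R) (P' : probability O' R)
    (X : random_field d P (discrete S)) (X' : random_field d P' (discrete S)) :
    Prop :=
  forall V : set 'rV[int]_d, finite_set V ->
    support_on X (boundary V) = support_on X' (boundary V) /\
    forall tau, support_on X (boundary V) tau ->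
      specification X tau = specification X' tau.

Section codings.
Context (d : nat) (S : pointedType) (R : realType).
Context (dT : measure_display) (T : measurableType dT).
Implicit Type phi : config d T -> config d (discrete S).

Definition coding (dO dO' : measure_display) (O : measurableType dO)
    (O' : measurableType dO') (Q : probability O R) (P : probability O' R)
    (Y : random_field d Q T) (X : random_field d P (discrete S)) phi : Prop :=
  [/\ measurable_fun setT phi,
      forall u y, phi (shift u y) = shift u (phi y) &
      same_law Q (phi \o sample Y) P (sample X)].

(* The infimum of a set of integers is its minimum, and +oo if it is empty. *)
Definition coding_radius phi (y : config d T) : \bar R :=
  ereal_inf [set (r%:R)%:E | r in [set r : nat |
    forall y' : config d T, (forall v, l1ball d r v -> y' v = y v) ->
      phi y' 0 = phi y 0]].

(* The event of a finite coding radius need not be measurable: almost surely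
   means that its complement is contained in a null set. *)
Definition finitary (dO : measure_display) (O : measurableType dO)
    (Q : probability O R) (Y : random_field d Q T) phi : Prop :=
  {ae Q, forall w, (coding_radius phi (sample Y w) < +oo)%E}.

End codings.

Definition ffiid (d : nat) (S : pointedType) (R : realType)
    (dO : measure_display) (O : measurableType dO) (P : probability O R)
    (X : random_field d P (discrete S)) : Prop :=
  exists (dT : measure_display) (T : measurableType dT)
    (dQ : measure_display) (O' : measurableType dQ) (Q : probability O' R)
    (Y : random_field d Q T) (phi : config d T -> config d (discrete S)),
    [/\ iid Y, coding Y X phi & finitary Y phi].

Definition boundary_inf (d : nat) (S : pointedType) (R : realType)
    (dO dO' : measure_display) (O : measurableType dO) (O' : measurableType dO')
    (P : probability O R) (P' : probability O' R)
    (X : random_field d P (discrete S)) (X' : random_field d P' (discrete S))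
    (eps : R) (n : nat) : \bar R :=
  let D := boundary (box d n) in
  ereal_inf [set P (event X A) | A in
    [set A : set (D -> S) | A `<=` support_on X D /\
      ((1 - eps)%:E <= P' (event X' A))%E]].

(* Main.v *)
Require Import Defs.
From HB Require Import structures.
From mathcomp Require Import all_boot all_order all_algebra finmap ring lra zify.
From mathcomp Require Import all_classical all_reals all_analysis measurable_realfun.
Import Order.TTheory GRing.Theory Num.Theory.
Import numFieldNormedType.Exports.
Local Open Scope classical_set_scope.
Local Open Scope ring_scope.

(** Why the theorem holds.  A finitary factor of an i.i.d. process concentrates
    exponentially fast in the volume, whereas the boundary hypothesis gives
    events typical for [X'] a probability under [X] that is subexponential in
    the volume.

    Two distinct ergodic laws are mutually singular: the union of all translates
    of a negative set in the Hahn decomposition of their difference is an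
    invariant event on which they still differ, so by the zero-one laws it has
    probability 1 under one and 0 under the other ([invariant_separation]).
    Approximating this event gives a local event [B] that is nearly sure for [X]
    and nearly impossible for [X'] ([local_separation]).  With such an event,
    Markov's inequality takes care of [X']: for any finite family of sites, with
    large probability at most half of the translates of [B] to these sites occur
    ([few_shifts_bound]).

    Under [X] the situation is reversed.  Suppose [X] is coded by [phi] from an
    i.i.d. process.  Since the coding radius is almost surely finite, the
    preimage of [B] under [phi] contains, up to a small probability, an event
    [H] that depends on a finite window and forces [B] almost surely
    ([ess_open_local]).  Along a grid of sites coarser than the window, the
    translates of [H] are independent, so that a union bound makes it
    exponentially unlikely in the number of sites that half of them fail
    ([coding_concentration]).  The grid inside the box of radius [n] has order
    [n ^ d] sites.

    Let [G] be the event that at least half of the translates of [B] along the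
    grid fail: it is likely for [X'], has probability [exp (- K n ^ d)] at most
    for [X], and depends on the box only.  Let [Z] be the set of boundary
    conditions under which the common specification gives [G] probability at
    least 1/2.  Then [Z] is likely for [X'], and [P (X in Z)] is at most twice
    [P (X in G)] ([boundary_transfer]).  Hence the infimum in the hypothesis
    decays exponentially in the volume ([ffiid_boundary_decay]), which
    contradicts the lower bound. *)

Set Implicit Arguments.
Unset Strict Implicit.
Unset Printing Implicit Defensive.

Local Notation shift := Defs.shift.

(** * Measurability on configuration spaces *)

Section config_measurability.
Context (d : nat) (dT : measure_display) (T : measurableType dT).
Local Notation E := (config d T).

Lemma measurable_coord (v : 'rV[int]_d) :
  measurable_fun setT (fun x : E => x v).
Proof.
move=> _ A mA; rewrite setTI; apply: sub_sigma_algebra.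
by exists v => //; exists A => //; rewrite setTI.
Qed.

Lemma measurable_config (dO : measure_display) (O : measurableType dO)
    (f : O -> E) :
  (forall v, measurable_fun setT (fun w => f w v)) -> measurable_fun setT f.
Proof.
move=> mf; apply: (@measurability _ _ _ E setT f (@cylinders d dT T)) => //.
move=> _ [_ [v _ [A mA <-]] <-].
by rewrite !setTI; have := mf v measurableT A mA; rewrite setTI.
Qed.

Lemma measurable_shift (u : 'rV[int]_d) : measurable_fun setT (@Defs.shift d dT T u).
Proof. by apply: measurable_config => v; exact: measurable_coord. Qed.

Lemma measurable_shift_preimage (u : 'rV[int]_d) (A : set E) :
  measurable A -> measurable (shift u @^-1` A).
Proof. by move=> mA; rewrite -[X in measurable X]setTI; exact: measurable_shift. Qed.

Lemma shift_shift (u v : 'rV[int]_d) (x : E) :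
  shift u (shift v x) = shift (u + v) x.
Proof. by apply/funext => w; rewrite /shift addrA. Qed.

Lemma config_shift0 (x : E) : shift 0 x = x.
Proof. by apply/funext => v; rewrite /Defs.shift addr0. Qed.

Definition rectangle (V : {fset 'rV[int]_d}) (A : 'rV[int]_d -> set T) : set E :=
  [set x | forall v, v \in V -> A v (x v)].

Definition rectangles : set_system E :=
  [set B | exists V A, (forall v, measurable (A v)) /\ B = rectangle V A].

Lemma measurable_rectangle V A :
  (forall v, measurable (A v)) -> measurable (rectangle V A).
Proof.
move=> mA.
have -> : rectangle V A = \bigcap_(v in [set` V]) (fun x : E => x v) @^-1` A v.
  by apply/seteqP; split => x H v; exact: H.
rewrite bigcap_fset; apply: big_rec => [|v B _ mB]; first exact: measurableT.
apply: measurableI => //.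
by rewrite -[X in measurable X]setTI; exact: measurable_coord.
Qed.

Lemma rectangles_generate : @measurable _ E = <<s rectangles >>.
Proof.
apply/seteqP; split.
  apply: sub_smallest2r; last first.
    move=> _ [v _ [A mA <-]]; exists [fset v]%fset, (fun=> A); split => //.
    rewrite setTI; apply/seteqP; split => x /=.
      by move=> Ax w; rewrite inE => /eqP ->.
    by move=> /(_ v); apply; rewrite inE.
  exact: smallest_sigma_algebra.
apply: smallest_sub; first exact: sigma_algebra_measurable.
by move=> _ [V [A [mA ->]]]; exact: measurable_rectangle.
Qed.

Lemma setI_closed_rectangles : setI_closed rectangles.
Proof.
move=> _ _ [V [A [mA ->]]] [W [B [mB ->]]].
exists (V `|` W)%fset, (fun v => (if v \in V then A v else setT) `&`
  (if v \in W then B v else setT)); split.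
  by move=> v; apply: measurableI; case: ifP.
apply/seteqP; split => x /=.
  move=> [HA HB] v _; split; first by case: ifP => // /HA.
  by case: ifP => // /HB.
move=> H; split => v vV.
  by have := H v; rewrite inE vV /= => /(_ isT) [].
by have := H v; rewrite inE vV orbT /= => /(_ isT) [].
Qed.

Lemma config_measure_unique (R : realType)
    (m1 m2 : {measure set E -> \bar R}) :
  (m1 setT < +oo)%E ->
  (forall V A, (forall v, measurable (A v)) ->
    m1 (rectangle V A) = m2 (rectangle V A)) ->
  forall A, measurable A -> m1 A = m2 A.
Proof.
move=> m1oo m12 A mA.
have G0 : rectangles setT.
  exists fset0%fset, (fun=> setT); split => //.
  by apply/seteqP; split => x.
apply: (measure_unique rectangles (fun=> setT)) => //.
- exact: rectangles_generate.
- exact: setI_closed_rectangles.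
- by rewrite bigcup_const.
- by move=> _ [V [B [mB ->]]]; exact: m12.
Qed.

End config_measurability.

(** * Events determined by finitely many sites *)

Lemma absz_addn_le (a b : int) : (`|(a + b)%R| <= `|a| + `|b|)%N.
Proof. lia. Qed.

Section boxes.
Context (d : nat).

Lemma box_subset n m : (n <= m)%N -> box d n `<=` box d m.
Proof. by move=> nm v bv i; exact: leq_trans (bv i) nm. Qed.

Lemma box_exhaust (v : 'rV[int]_d) : exists n, box d n v.
Proof.
exists (\sum_(i < d) `|v ord0 i|)%N => i.
by rewrite (bigD1 i) //= leq_addr.
Qed.

Lemma box_translate n m (u v : 'rV[int]_d) :
  box d n v -> box d m u -> box d (n + m) (v + u).
Proof.
move=> nv mu i; rewrite mxE; apply: leq_trans (leq_add (nv i) (mu i)).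
exact: absz_addn_le.
Qed.

Lemma l1ball_box r : l1ball d r `<=` box d r.
Proof.
by move=> v vr i; apply: leq_trans vr; rewrite /l1norm (bigD1 i) //= leq_addr.
Qed.

End boxes.

Section dependence.
Context (d : nat) (dT : measure_display) (T : measurableType dT).
Local Notation E := (config d T).

Definition depends_on (W : set 'rV[int]_d) (A : set E) : Prop :=
  forall x y : E, (forall v, W v -> x v = y v) -> A x -> A y.

Lemma depends_onS (V W : set 'rV[int]_d) (A : set E) :
  V `<=` W -> depends_on V A -> depends_on W A.
Proof. by move=> VW VA x y xy; apply: VA => v /VW; exact: xy. Qed.

Lemma depends_onU (V : set 'rV[int]_d) (A B : set E) :
  depends_on V A -> depends_on V B -> depends_on V (A `|` B).
Proof. by move=> HA HB x y xy [/(HA _ _ xy)|/(HB _ _ xy)]; [left|right]. Qed.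

Lemma depends_onI (V : set 'rV[int]_d) (A B : set E) :
  depends_on V A -> depends_on V B -> depends_on V (A `&` B).
Proof. by move=> HA HB x y xy [/(HA _ _ xy) ? /(HB _ _ xy) ?]. Qed.

Lemma depends_onC (W : set 'rV[int]_d) (A : set E) :
  depends_on W A -> depends_on W (~` A).
Proof. by move=> AW x y xy nAx Ay; apply: nAx; apply: AW Ay => v /xy ->. Qed.

Lemma depends_on_shift n m (u : 'rV[int]_d) (A : set E) :
  depends_on (box d n) A -> box d m u ->
  depends_on (box d (n + m)) (shift u @^-1` A).
Proof.
move=> An mu x y xy; apply: An => v nv.
by rewrite /Defs.shift; apply: xy; exact: box_translate.
Qed.

End dependence.

(** * Independence under a product law *)

Section product_law.
Context (d : nat) (R : realType) (dT : measure_display) (T : measurableType dT).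
Local Notation E := (config d T).
Context (p : probability T R).

Definition product_law (q : {measure set E -> \bar R}) : Prop :=
  forall V A, (forall v, measurable (A v)) ->
    q (rectangle V A) = (\prod_(v <- V) p (A v))%E.

Definition splice (W : set 'rV[int]_d) (z : E * E) : E :=
  fun v => if v \in W then z.1 v else z.2 v.

Lemma measurable_splice W : measurable_fun setT (splice W).
Proof.
apply: measurable_config => v; rewrite /splice; case: (v \in W).
  exact: measurableT_comp (measurable_coord v) measurable_fst.
exact: measurableT_comp (measurable_coord v) measurable_snd.
Qed.

Variable q : probability E R.
Hypothesis pq : product_law q.

Lemma product_law_unique (m : {measure set E -> \bar R}) :
  product_law m -> forall A, measurable A -> m A = q A.
Proof.
move=> pm A mA; apply/esym.
apply: (@config_measure_unique d dT T R q m) => //.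
  by apply: (@le_lt_trans _ _ 1%E); [exact: (probability_le1 q measurableT)|exact: ltry].
by move=> V B mB; rewrite pq // pm.
Qed.

HB.instance Definition _ (W : set 'rV[int]_d) :=
  isMeasurableFun.Build _ _ _ _ (splice W) (@measurable_splice W).

(** Resampling all coordinates outside [W] from an independent copy does not
    change a product law, since it does not change the probability of a
    rectangle.  This one identity yields both the independence of disjoint
    regions and, through Fubini, conditioning on the coordinates in [W]. *)
Lemma splice_law (W : set 'rV[int]_d) (A : set E) : measurable A ->
  (q \x q)%E (splice W @^-1` A) = q A.
Proof.
move=> mA.
rewrite -[LHS]/(distribution (q \x q)%E (splice W) A).
apply: product_law_unique => // V B mB /=.
rewrite /distribution /pushforward.
have -> : splice W @^-1` rectangle V B =
  rectangle V (fun v => if v \in W then B v else setT) `*`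
  rectangle V (fun v => if v \in W then setT else B v).
  apply/seteqP; split => -[x y] /=.
    by move=> H; split => v vV; have := H v vV; rewrite /splice /=; case: ifP.
  move=> [H1 H2] v vV; have := H1 v vV; have := H2 v vV.
  by rewrite /splice /=; case: ifP.
rewrite product_measure1E; [|by apply: measurable_rectangle => v; case: ifP..].
rewrite !pq; [|by move=> v; case: ifP..].
rewrite -big_split /=; apply: eq_bigr => v _.
by case: ifP => _; rewrite probability_setT ?mul1e ?mule1.
Qed.

HB.instance Definition _ (u : 'rV[int]_d) :=
  isMeasurableFun.Build _ _ _ _ (@Defs.shift d dT T u)
    (@measurable_shift d dT T u).

Lemma shift_law (u : 'rV[int]_d) (A : set E) : measurable A ->
  q (shift u @^-1` A) = q A.
Proof.
move=> mA.
rewrite -[LHS]/(distribution q (shift u) A).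
apply: product_law_unique => // V B mB /=.
rewrite /distribution /pushforward.
have -> : shift u @^-1` rectangle V B =
  rectangle [fset (v + u)%R | v in V]%fset (fun v => B (v - u)).
  apply/seteqP; split => x /=.
    by move=> H _ /imfsetP[v /= vV ->]; rewrite addrK; exact: H.
  move=> H v vV; have := H (v + u); rewrite addrK; apply.
  exact: in_imfset.
rewrite pq // big_imfset /=; last by move=> v w _ _ /addIr.
by apply: eq_bigr => v _; rewrite addrK.
Qed.

(** After splicing along [W], the event [A] reads only the first copy and [B]
    only the second, so the preimage of their intersection is a product set. *)
Lemma depends_on_disjoint (W : set 'rV[int]_d) (A B : set E) :
  measurable A -> measurable B -> depends_on W A -> depends_on (~` W) B ->
  q (A `&` B) = (q A * q B)%E.
Proof.
move=> mA mB AW BW.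
rewrite -(@splice_law W); last exact: measurableI.
rewrite -product_measure1E //; congr ((_ \x _)%E _).
apply/seteqP; split => -[x y] /= [].
  move=> Axy Bxy; split.
    by apply: AW Axy => v Wv; rewrite /splice /= mem_set.
  by apply: BW Bxy => v Wv; rewrite /splice /= memNset.
move=> Ax By; split.
  by apply: AW Ax => v Wv; rewrite /splice /= mem_set.
by apply: BW By => v Wv; rewrite /splice /= memNset.
Qed.

End product_law.

(** * Rare events repeated at distant sites *)

Lemma measure_bigsetU_le_sum (d0 : measure_display) (R : realType)
    (T : measurableType d0) (mu : {measure set T -> \bar R}) (I : finType)
    (P : pred I) (A : I -> set T) :
  (forall i, measurable (A i)) ->
  (mu (\big[setU/set0]_(i | P i) A i) <= \sum_(i | P i) mu (A i))%E.
Proof.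
move=> mA.
suff [] : measurable (\big[setU/set0]_(i | P i) A i) /\
  (mu (\big[setU/set0]_(i | P i) A i) <= \sum_(i | P i) mu (A i))%E by [].
apply: (big_ind2 (fun B x => measurable B /\ mu B <= x)%E).
- by rewrite measure0.
- move=> B x C y [mB Bx] [mC Cy]; split; first exact: measurableU.
  apply: le_trans (leeD Bx Cy).
  exact: measureU2.
- by [].
Qed.

Section separated_events.
Context (d : nat) (R : realType) (dT : measure_display) (T : measurableType dT).
Local Notation E := (config d T).
Context (p : probability T R) (q : probability E R) (pq : product_law p q).
Context (m : nat) (C : set E) (mC : measurable C)
  (C_box : depends_on (box d m) C).

Definition spread_out (s : seq 'rV[int]_d) : Prop :=
  forall u v w, u \in s -> v \in s -> u != v ->
    box d m (w - u) -> box d m (w - v) -> False.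

Definition all_shifts (s : seq 'rV[int]_d) : set E :=
  [set x | forall u, u \in s -> C (shift u x)].

Lemma all_shifts_cons u s :
  all_shifts (u :: s) = shift u @^-1` C `&` all_shifts s.
Proof.
apply/seteqP; split => x /=.
  by move=> H; split => [|v vs]; apply: H; rewrite inE ?eqxx ?vs ?orbT.
by move=> [H1 H2] v; rewrite inE => /orP[/eqP ->|/H2].
Qed.

Lemma measurable_all_shifts s : measurable (all_shifts s).
Proof.
elim: s => [|u s IH].
  by rewrite (_ : all_shifts [::] = setT) //; apply/seteqP; split.
by rewrite all_shifts_cons; apply: measurableI => //; exact: measurable_shift_preimage.
Qed.

(** The windows around distinct sites are disjoint, so the events split off one
    at a time by independence. *)
Lemma all_shifts_bound (rho : R) s : (q C <= rho%:E)%E ->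
  uniq s -> spread_out s -> (q (all_shifts s) <= (rho ^+ size s)%:E)%E.
Proof.
move=> qC; elim: s => [|u s IH] /=; first by rewrite expr0 probability_le1 //;
  exact: measurable_all_shifts.
move=> /andP[us uniqs] sep.
rewrite all_shifts_cons (depends_on_disjoint pq (W := [set w | box d m (w - u)])).
- rewrite exprS EFinM; apply: lee_pmul => //.
    by rewrite (shift_law pq).
  apply: IH => // v w z vs ws; apply: sep; by rewrite inE ?vs ?ws orbT.
- exact: measurable_shift_preimage.
- exact: measurable_all_shifts.
- move=> x y xy; apply: C_box => v bv.
  by rewrite /Defs.shift; apply: xy; rewrite /= addrK.
- move=> x y xy H v vs; apply: C_box (H v vs) => w bw.
  rewrite /Defs.shift; apply: xy => /= bwu.
  apply: (sep u v (w + v)) => //; rewrite ?inE ?eqxx ?vs ?orbT ?addrK //.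
  by apply: contraNneq us => ->.
Qed.

Context (I : finType) (pos : I -> 'rV[int]_d).

(** At least half of the translates occur, counted with the indices in [I]. *)
Definition many_shifts : set E :=
  [set x | (#|I| <= 2 * #|[set i | `[< C (shift (pos i) x) >]]%SET|)%N].

Lemma many_shiftsE : many_shifts =
  \big[setU/set0]_(A in [pred A : {set I} | (#|I| <= 2 * #|A|)%N])
     all_shifts [seq pos i | i <- enum A].
Proof.
rewrite -bigcup_pred; apply/seteqP; split => x.
  move=> H; exists [set i | `[< C (shift (pos i) x) >]]%SET.
    by rewrite /= inE; exact: H.
  move=> u /mapP[i]; rewrite mem_enum inE => /asboolP; by move=> ? ->.
move=> [A /=]; rewrite inE => HA AC; apply: leq_trans HA _; rewrite leq_mul2l /=.
apply: subset_leq_card; apply/fintype.subsetP => i iA; rewrite inE; apply/asboolP.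
by apply: AC; apply/mapP; exists i; rewrite ?mem_enum.
Qed.

Lemma measurable_many_shifts : measurable many_shifts.
Proof.
rewrite many_shiftsE; apply: bigsetU_measurable => A _.
exact: measurable_all_shifts.
Qed.

(** A union bound over the at most [2 ^ #|I|] sets of indices at which the event
    may occur.  Each has at least [#|I| / 2] elements, and is charged
    [(rho ^+ 2) ^+ (#|I| / 2)]; the square in the hypothesis avoids a root. *)
Lemma many_shifts_bound (rho : R) : 0 <= rho -> rho <= 1 ->
  injective pos -> spread_out [seq pos i | i <- enum I] ->
  (q C <= (rho ^+ 2)%:E)%E ->
  (q many_shifts <= ((2 * rho) ^+ #|I|)%:E)%E.
Proof.
move=> rho0 rho1 injpos sep qC.
rewrite many_shiftsE; apply: le_trans (measure_bigsetU_le_sum _ _ _) _.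
  by move=> A; exact: measurable_all_shifts.
apply: (@le_trans _ _ (\sum_(A : {set I}) (rho ^+ #|I|)%:E)%E).
  rewrite big_mkcond /=; apply: lee_sum => A _; rewrite inE.
  case: ifP => HA; last by rewrite lee_fin exprn_ge0.
  apply: le_trans (all_shifts_bound qC _ _) _.
  - by rewrite map_inj_uniq ?enum_uniq.
  - move=> u v w /mapP[i _ ->] /mapP[j _ ->]; apply: sep;
      by apply: map_f; rewrite mem_enum.
  - rewrite lee_fin size_map -cardE -exprM.
    exact: ler_wiXn2l.
have card_sets : #|{: {set I}}| = (2 ^ #|I|)%N.
  by rewrite -[LHS](cardsT {set I}) -finset.powersetT card_powerset cardsT.
by rewrite sumEFin lee_fin sumr_const card_sets exprMn -natrX mulr_natl.
Qed.

End separated_events.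

(** * Approximation by local events *)

Lemma measure_small (d0 : measure_display) (R : realType)
    (T : measurableType d0) (mu : {measure set T -> \bar R}) (F : (set T)^nat)
    (e : R) : (mu setT < +oo)%E -> (forall n, measurable (F n)) ->
  {homo F : n m / (n <= m)%N >-> (m <= n)%O} -> \bigcap_n F n = set0 ->
  0 < e -> exists n, (mu (F n) < e%:E)%E.
Proof.
move=> muoo mF ndF F0 e0; apply: contrapT => /forallNP H.
have F0oo : (mu (F 0%N) < +oo)%E.
  by apply: le_lt_trans muoo; apply: le_measure; rewrite ?inE.
have mcap : measurable (\bigcap_n F n) by rewrite F0.
have cv := nonincreasing_cvg_mu F0oo mF mcap ndF.
rewrite F0 measure0 in cv.
have : (e%:E <= lim ((mu \o F) x @[x --> \oo]))%E.
  apply: lime_ge; first by apply/cvg_ex; exists 0%E.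
  by near=> n; rewrite leNgt; apply/negP; exact: H.
rewrite (cvg_lim _ cv) // lee_fin; by rewrite leNgt e0.
Unshelve. all: by end_near. Qed.

Section approximation.
Context (d : nat) (R : realType) (dT : measure_display) (T : measurableType dT).
Local Notation E := (config d T).

(** The algebra generated by the coordinates, as an inductive family, so that
    measurability, locality and finitary codability are all proved by induction
    on the way an event is built. *)
Inductive local_event : set E -> Prop :=
| local_coord v A : measurable A -> local_event ((fun x : E => x v) @^-1` A)
| localC B : local_event B -> local_event (~` B)
| localU B C : local_event B -> local_event C -> local_event (B `|` C).

Lemma measurable_local_event B : local_event B -> measurable B.
Proof.
elim=> [v A mA|C _ mC|C D _ mC _ mD].
- by rewrite -[X in measurable X]setTI; exact: measurable_coord.
- exact: measurableC.
- exact: measurableU.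
Qed.

Lemma local_event_box B : local_event B -> exists n, depends_on (box d n) B.
Proof.
elim=> [v A _|C _ [n Cn]|C D _ [n Cn] _ [m Dm]].
- have [n vn] := box_exhaust v; exists n => x y xy /=.
  by rewrite xy.
- by exists n; exact: depends_onC.
- exists (maxn n m) => x y xy [Cx|Dx]; [left|right].
    by apply: (depends_onS _ Cn) Cx; [exact: box_subset (leq_maxl n m)|].
  by apply: (depends_onS _ Dm) Dx; [exact: box_subset (leq_maxr n m)|].
Qed.

Context (mu : {measure set E -> \bar R}) (muoo : (mu setT < +oo)%E).

Definition approximable (B : set E) : Prop :=
  measurable B /\ forall e : R, 0 < e ->
    exists2 C, local_event C & (mu (B `+` C) < e%:E)%E.

Lemma measurableY (A B : set E) :
  measurable A -> measurable B -> measurable (A `+` B).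
Proof.
by move=> mA mB; rewrite setY_def; apply: measurableU; exact: measurableD.
Qed.

Lemma approximableU A B : approximable A -> approximable B ->
  approximable (A `|` B).
Proof.
move=> [mA hA] [mB hB]; split; first exact: measurableU.
move=> e e0; have e20 : 0 < e / 2 by rewrite divr_gt0.
have [C lC AC] := hA _ e20; have [D lD BD] := hB _ e20.
have mC := measurable_local_event lC; have mD := measurable_local_event lD.
exists (C `|` D); first exact: localU.
rewrite [e]splitr EFinD; apply: le_lt_trans (lteD AC BD).
apply: le_trans (measureU2 _ _ _); try exact: measurableY.
apply: le_measure; rewrite ?inE; [|apply: measurableU|].
- by apply: measurableY; exact: measurableU.
- exact: measurableY.
- exact: measurableY.
- move=> x; rewrite !setY_def /=; tauto.
Qed.

Lemma approximableC A : approximable A -> approximable (~` A).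
Proof.
move=> [mA hA]; split; first exact: measurableC.
move=> e e0; have [C lC AC] := hA _ e0; exists (~` C); first exact: localC.
suff -> : ~` A `+` ~` C = A `+` C by [].
apply/seteqP; split => x; rewrite !setY_def /=.
  by move=> [[H /contrapT]|[H /contrapT]]; tauto.
by move=> [[]|[]]; tauto.
Qed.

Lemma approximable0 : approximable set0.
Proof.
split => // e e0; exists ((fun x : E => x 0) @^-1` set0).
  exact: local_coord.
by rewrite preimage_set0 setYK measure0 lte_fin.
Qed.

(** Half of the error is spent on replacing the countable union by a finite
    one, which is possible because the measure is finite, and half on
    approximating the finite union. *)
Lemma approximable_bigcup (F : (set E)^nat) :
  (forall n, approximable (F n)) -> approximable (\bigcup_n F n).
Proof.
move=> hF.
pose U n := \big[setU/set0]_(i < n) F i.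
have hU n : approximable (U n).
  by apply: big_rec => [|i B _ hB]; [exact: approximable0|exact: approximableU].
have mUF : measurable (\bigcup_n F n).
  by apply: bigcupT_measurable => n; have [] := hF n.
have mU n : measurable (U n) by have [] := hU n.
split => // e e0; have e20 : 0 < e / 2 by rewrite divr_gt0.
have [n] : exists n, (mu (\bigcup_n F n `\` U n) < (e / 2)%:E)%E.
  apply: (@measure_small _ _ _ mu (fun n => \bigcup_n F n `\` U n)) => //.
  - by move=> n; exact: measurableD.
  - move=> n m nm; apply/subsetPset => x [Fx Um]; split => //; apply: contra_not Um.
    by rewrite /U -!bigcup_mkord => -[i /= im Fi]; exists i => //=; exact: leq_trans nm.
  - apply/seteqP; split => // x H; have [[i _ Fi] _] := H 0%N I.
    have [_] := H i.+1 I; apply; rewrite /U -bigcup_mkord.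
    by exists i => /=.
have [_ /(_ _ e20)[C lC UC]] := hU n; move=> FU.
have mC := measurable_local_event lC.
exists C => //.
rewrite [e]splitr EFinD; apply: le_lt_trans (lteD FU UC).
apply: le_trans (measureU2 _ _ _); [|exact: measurableD|exact: measurableY].
apply: le_measure; rewrite ?inE; [exact: measurableY| |].
  by apply: measurableU; [exact: measurableD|exact: measurableY].
have UF : U n `<=` \bigcup_n F n by rewrite /U -bigcup_mkord => x [i _]; exists i.
move=> x; rewrite !setY_def /=.
have := UF x; have [Ux|nUx] := pselect (U n x); tauto.
Qed.

Lemma measurable_approximable B : measurable B -> approximable B.
Proof.
move=> mB; apply: (smallest_sub _ _ mB).
  split => [|A hA|F]; first exact: approximable0.
    by rewrite setTD; exact: approximableC.
  exact: approximable_bigcup.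
move=> _ [v _ [A mA <-]]; rewrite setTI.
split; first by rewrite -[X in measurable X]setTI; exact: measurable_coord.
move=> e e0; eexists; first exact: (local_coord v mA).
by rewrite setYK measure0 lte_fin.
Qed.

End approximation.

Section separation.
Context (d : nat) (R : realType) (dT : measure_display) (T : measurableType dT).
Local Notation E := (config d T).
Context (mu1 mu2 : probability E R).

Definition invariant_law (mu : probability E R) :=
  forall u A, measurable A -> mu (shift u @^-1` A) = mu A.

Definition zero_one_law (mu : probability E R) :=
  forall A : set E, measurable A -> (forall u, shift u @^-1` A = A) ->
    mu A = 0%E \/ mu A = 1%E.

(** Distinct ergodic laws are mutually singular.  A negative set of
    [mu2 - mu1] stays negative under translation, and countable unions of
    negative sets are negative; so the union of all translates is an invariant
    negative set, and it carries enough of the difference for the two measures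
    to disagree on it.  The zero-one laws leave only the values 1 and 0. *)
Lemma invariant_separation :
  invariant_law mu1 -> invariant_law mu2 ->
  zero_one_law mu1 -> zero_one_law mu2 ->
  (exists2 A, measurable A & mu1 A <> mu2 A) ->
  exists D : set E, [/\ measurable D, mu1 D = 1%E & mu2 D = 0%E].
Proof.
move=> inv1 inv2 zo1 zo2 [A0 mA0 neqA0].
have [A mA ltA] : exists2 A, measurable A & (mu2 A < mu1 A)%E.
  have [lt|] := ltP (mu2 A0) (mu1 A0); first by exists A0.
  rewrite le_eqVlt => /predU1P[//|lt]; exists (~` A0); first exact: measurableC.
  rewrite !probability_setC //; move: lt.
  rewrite -(fineK (fin_num_measure mu1 _ mA0)) -(fineK (fin_num_measure mu2 _ mA0)).
  by rewrite -!EFinB !lte_fin ltrD2l ltrN2.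
pose nu := cadd (charge_of_finite_measure mu2) (copp (charge_of_finite_measure mu1)).
have nuE B : nu B = (mu2 B - mu1 B)%E by [].
have [Pos [N [[mPos posP] [mN negN] PN _]]] := Hahn_decomposition nu.
(* The translates of N, listed through a numbering of the sites. *)
pose F n : set E :=
  oapp (fun u : 'rV[int]_d => shift u @^-1` N) set0 (choice.unpickle n).
have negF n : negative_set nu (F n).
  rewrite /F; case: (choice.unpickle n) => [u|]; last exact: negative_set0.
  split=> [|B mB BN]; first exact: measurable_shift_preimage.
  have BE : B = shift u @^-1` (shift (- u) @^-1` B).
    apply/seteqP; split => x /=; by rewrite shift_shift addNr config_shift0.
  have mB' : measurable (shift (- u) @^-1` B) by exact: measurable_shift_preimage.
  rewrite nuE BE inv1 // inv2 // -nuE; apply: negN => // x /= /BN /=.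
  by rewrite shift_shift subrr config_shift0.
pose D := \bigcup_n F n.
have [mD negD] := bigcup_negative_set negF.
have ND : N `<=` D.
  move=> x Nx; exists (choice.pickle (0 : 'rV[int]_d)) => //; rewrite /F choice.pickleK /=.
  by rewrite config_shift0.
have invD u : shift u @^-1` D = D.
  apply/seteqP; split => x [n _]; rewrite {1}/F; case E0 : (choice.unpickle n) => [v|] //= Nv.
    exists (choice.pickle (v + u)) => //; rewrite /F choice.pickleK /=.
    by rewrite -shift_shift.
  exists (choice.pickle (v - u)) => //; rewrite /F choice.pickleK /=.
  by rewrite shift_shift subrK.
(* Compare D with A: the part of A outside D is positive for mu2 - mu1, and the
   part of D outside A is negative, so D differs at least as much as A. *)
have ltD : (mu2 D < mu1 D)%E.
  have mAD : measurable (A `&` D) by exact: measurableI.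
  have h1 : (0 <= nu (A `\` D))%E.
    apply: posP; first exact: measurableD.
    move=> x [_ nD]; have : (Pos `|` N) x by rewrite PN.
    by case => // /ND.
  have h2 : (nu (D `\` A) <= 0)%E.
    by apply: negD; [exact: measurableD|exact: subDsetl].
  move: h1 h2; rewrite !nuE.
  have e (mu : probability E R) B C : measurable B -> measurable C ->
      (mu B = mu (B `\` C) + mu (B `&` C))%E.
    move=> mB mC; rewrite -measureU //.
    - by rewrite setUC setUIDK.
    - exact: measurableD.
    - exact: measurableI.
    - by apply/seteqP; split => x // [[_ H] [_ ?]].
  move: ltA; rewrite (e mu1 A D) // (e mu2 A D) // (e mu1 D A) // (e mu2 D A) //.
  rewrite (setIC D A).
  have f (mu : probability E R) B : measurable B -> mu B = (fine (mu B))%:E.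
    by move=> mB; rewrite fineK // fin_num_measure.
  rewrite (f mu1 _ mAD) (f mu2 _ mAD).
  have mAnD : measurable (A `\` D) by exact: measurableD.
  have mDnA : measurable (D `\` A) by exact: measurableD.
  rewrite (f mu1 _ mAnD) (f mu2 _ mAnD) (f mu1 _ mDnA) (f mu2 _ mDnA).
  move: (fine _) (fine _) (fine _) (fine _) (fine _) (fine _) => a b a' b' c c'.
  rewrite -!EFinB -!EFinD !lte_fin !lee_fin => H1 H2 H3; lra.
have [D1|D1] := zo1 D mD invD; have [D2|D2] := zo2 D mD invD;
  move: ltD; rewrite D1 D2 ?ltxx //.
  by rewrite lte_fin ltr10.
by exists D.
Qed.

End separation.

Section local_separation.
Context (d : nat) (R : realType) (dT : measure_display) (T : measurableType dT).
Context (mu1 mu2 : probability (config d T) R).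

(** The separating event is approximated in the sum of the two laws, so that
    one local event serves both. *)
Lemma local_separation (e : R) :
  invariant_law mu1 -> invariant_law mu2 ->
  zero_one_law mu1 -> zero_one_law mu2 ->
  (exists2 A, measurable A & mu1 A <> mu2 A) -> 0 < e ->
  exists B, [/\ local_event B, (mu1 (~` B) < e%:E)%E & (mu2 B < e%:E)%E].
Proof.
move=> inv1 inv2 zo1 zo2 neq e0.
have [D [mD D1 D2]] := invariant_separation inv1 inv2 zo1 zo2 neq.
have addoo : (measure_add mu1 mu2 setT < +oo)%E.
  rewrite measure_addE; apply: lte_add_pinfty.
    exact: (le_lt_trans (probability_le1 mu1 measurableT) (ltry 1)).
  exact: (le_lt_trans (probability_le1 mu2 measurableT) (ltry 1)).
have [_ /(_ _ e0)[B lB DB']] := measurable_approximable addoo mD.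
have DB : (mu1 (D `+` B) + mu2 (D `+` B) < e%:E)%E by rewrite -measure_addE.
have mB := measurable_local_event lB.
have mDB : measurable (D `+` B) by exact: measurableY.
exists B; split => //.
- apply: le_lt_trans DB; apply: (@le_trans _ _ (mu1 (D `+` B))); last first.
    by rewrite leeDl.
  have DC : mu1 (~` D) = 0%E by rewrite probability_setC // D1 subee.
  apply: (@le_trans _ _ (mu1 ((D `+` B) `|` ~` D))).
    apply: le_measure; rewrite ?inE.
    + exact: measurableC.
    + by apply: measurableU => //; exact: measurableC.
    + by move=> x nBx; have [Dx|nDx] := pselect (D x); [left; left|right].
  apply: le_trans (measureU2 _ _ _) _ => //; first exact: measurableC.
  by rewrite [X in (_ + X)%E]DC adde0.
- apply: le_lt_trans DB; apply: (@le_trans _ _ (mu2 (D `+` B))); last first.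
    by rewrite leeDr.
  apply: (@le_trans _ _ (mu2 ((D `+` B) `|` D))).
    apply: le_measure; rewrite ?inE //.
    + exact: measurableU.
    + by move=> x Bx; have [Dx|nDx] := pselect (D x); [right|left; right].
  apply: le_trans (measureU2 _ _ _) _ => //.
  by rewrite [X in (_ + X)%E]D2 adde0.
Qed.

End local_separation.

(** * Events forced by finite windows *)

Section inner_windows.
Context (d : nat) (R : realType) (dT : measure_display) (T : measurableType dT).
Local Notation E := (config d T).
Context (p : probability T R) (q : probability E R) (pq : product_law p q).

(** Up to a null set, [W] is a countable union of events depending on finite
    windows, which is how an open set looks to [q]. *)
Definition ess_open (W : set E) : Prop :=
  measurable W /\ forall e : R, 0 < e ->
    exists n H, [/\ measurable H, depends_on (box d n) H,
      q (H `\` W) = 0%E & (q (W `\` H) < e%:E)%E].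

Lemma measure_eq0U (A B : set E) : measurable A -> measurable B ->
  q A = 0%E -> q B = 0%E -> q (A `|` B) = 0%E.
Proof.
move=> mA mB A0 B0; apply: measure_negligible; first exact: measurableU.
by apply: negligibleU; exact/negligibleP.
Qed.

Lemma measure_eq0S (A B : set E) : measurable A -> measurable B ->
  A `<=` B -> q B = 0%E -> q A = 0%E.
Proof.
move=> mA mB AB B0; apply/eqP; rewrite -measure_le0 -B0.
by apply: le_measure; rewrite ?inE.
Qed.

Lemma ess_openU W W' : ess_open W -> ess_open W' -> ess_open (W `|` W').
Proof.
move=> [mW hW] [mW' hW']; split; first exact: measurableU.
move=> e e0; have e20 : 0 < e / 2 by rewrite divr_gt0.
have [n [H [mH Hn HW WH]]] := hW _ e20.
have [m [K [mK Km KW WK]]] := hW' _ e20.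
have mWW' : measurable (W `|` W') by exact: measurableU.
have mHK : measurable (H `|` K) by exact: measurableU.
exists (maxn n m), (H `|` K); split => //.
- apply: depends_onU; [apply: depends_onS Hn|apply: depends_onS Km];
    apply: box_subset; by rewrite ?leq_maxl ?leq_maxr.
- apply: (@measure_eq0S _ ((H `\` W) `|` (K `\` W'))).
  + exact: measurableD.
  + by apply: measurableU; exact: measurableD.
  + by move=> x /=; tauto.
  + by apply: measure_eq0U => //; exact: measurableD.
- rewrite [e]splitr EFinD; apply: le_lt_trans (lteD WH WK).
  apply: le_trans (measureU2 _ _ _); try exact: measurableD.
  apply: le_measure; rewrite ?inE; [exact: measurableD| |].
    by apply: measurableU; exact: measurableD.
  by move=> x /=; tauto.
Qed.

Lemma ess_openI W W' : ess_open W -> ess_open W' -> ess_open (W `&` W').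
Proof.
move=> [mW hW] [mW' hW']; split; first exact: measurableI.
move=> e e0; have e20 : 0 < e / 2 by rewrite divr_gt0.
have [n [H [mH Hn HW WH]]] := hW _ e20.
have [m [K [mK Km KW WK]]] := hW' _ e20.
have mWW' : measurable (W `&` W') by exact: measurableI.
have mHK : measurable (H `&` K) by exact: measurableI.
exists (maxn n m), (H `&` K); split => //.
- apply: depends_onI; [apply: depends_onS Hn|apply: depends_onS Km];
    apply: box_subset; by rewrite ?leq_maxl ?leq_maxr.
- apply: (@measure_eq0S _ ((H `\` W) `|` (K `\` W'))).
  + exact: measurableD.
  + by apply: measurableU; exact: measurableD.
  + by move=> x /=; have := pselect (W x); tauto.
  + by apply: measure_eq0U => //; exact: measurableD.
- rewrite [e]splitr EFinD; apply: le_lt_trans (lteD WH WK).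
  apply: le_trans (measureU2 _ _ _); try exact: measurableD.
  apply: le_measure; rewrite ?inE; [exact: measurableD| |].
    by apply: measurableU; exact: measurableD.
  by move=> x /=; have := pselect (H x); tauto.
Qed.

(** The window moves with the event; a larger box around the origin still
    contains it. *)
Lemma ess_open_shift u W : ess_open W -> ess_open (shift u @^-1` W).
Proof.
move=> [mW hW]; split; first exact: measurable_shift_preimage.
move=> e /hW[n [H [mH Hn HW WH]]]; have [m mu] := box_exhaust u.
exists (n + m)%N, (shift u @^-1` H); split.
- exact: measurable_shift_preimage.
- exact: depends_on_shift.
- exact: etrans (shift_law pq u (measurableD mH mW)) HW.
- have mWH : measurable (W `\` H) by exact: measurableD.
  by rewrite -(shift_law pq u mWH) in WH.
Qed.

(** The configurations whose restriction to the window [box d k] makes [W]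
    conditionally almost sure.  The exact analogue, asking that every
    configuration with this restriction lie in [W], need not be measurable. *)
Definition window_core (k : nat) (W : set E) : set E :=
  [set y | q (xsection (splice (box d k) @^-1` W) y) = 1%E].

Lemma measurable_splice_preimage k W : measurable W ->
  measurable (splice (box d k) @^-1` W : set (E * E)).
Proof.
by move=> mW; rewrite -[X in measurable X]setTI; exact: measurable_splice.
Qed.

Lemma measurable_window_core k W : measurable W -> measurable (window_core k W).
Proof.
move=> mW.
have mf := measurable_fun_xsection q (measurable_splice_preimage k mW).
have -> : window_core k W =
    setT `&` (q \o xsection (splice (box d k) @^-1` W)) @^-1` [set 1%E].
  by rewrite setTI.
exact: mf.
Qed.

Lemma depends_on_window_core k W : depends_on (box d k) (window_core k W).
Proof.
move=> x y xy; rewrite /window_core /=.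
suff -> : xsection (splice (box d k) @^-1` W) x =
          xsection (splice (box d k) @^-1` W) y by [].
rewrite !xsectionE; apply/seteqP.
have e z : splice (box d k) (x, z) = splice (box d k) (y, z).
  apply/funext => v; rewrite /splice /=; case: ifP => // /set_mem; exact: xy.
by split => z /=; rewrite e.
Qed.

(** By [splice_law] the measure is the average over [y] of the probability that
    the spliced configuration leaves [W] while [y] is in the core, and this
    probability vanishes by the definition of the core. *)
Lemma window_core_setD k W : measurable W -> q (window_core k W `\` W) = 0%E.
Proof.
move=> mW; have mH := measurable_window_core k mW.
have mD : measurable (window_core k W `\` W) by exact: measurableD.
rewrite -(splice_law pq (box d k) mD).
rewrite /product_measure1 integral0_eq // => y _ /=.
have [Hy|nHy] := pselect (window_core k W y); last first.
  rewrite [X in q X](_ : _ = set0) ?measure0 //.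
  rewrite xsectionE; apply/seteqP; split => z //= [Hyz _]; apply: nHy.
  apply: depends_on_window_core Hyz => v bv.
  by rewrite /splice /= mem_set.
apply: (@measure_eq0S _ (~` xsection (splice (box d k) @^-1` W) y)).
- apply: measurable_xsection; exact: measurable_splice_preimage.
- apply: measurableC; apply: measurable_xsection; exact: measurable_splice_preimage.
- by rewrite !xsectionE => z [].
- rewrite probability_setC; first by rewrite Hy subee.
  apply: measurable_xsection; exact: measurable_splice_preimage.
Qed.

Lemma window_core_forced k W y :
  (forall y', (forall v, box d k v -> y' v = y v) -> W y') ->
  window_core k W y.
Proof.
move=> H; rewrite /window_core /= [X in q X](_ : _ = setT) ?probability_setT //.
rewrite xsectionE; apply/seteqP; split => z // _ /=.
by apply: H => v bv; rewrite /splice /= mem_set.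
Qed.

(** Almost every point of [W] lies in a core of [W]: it lies in a core of [W] or
    of its complement, and cores of the complement meet [W] in null sets.  The
    union of the first few cores of [W] is then the required window event. *)
Lemma ess_open_forced W : measurable W ->
  q (\bigcup_k (window_core k W `|` window_core k (~` W))) = 1%E ->
  ess_open W.
Proof.
move=> mW full; split => // e e0.
have mWC : measurable (~` W) by exact: measurableC.
have mH k := measurable_window_core k mW.
have mHC k := measurable_window_core k mWC.
pose U n := \bigcup_(k < n) window_core k W.
have mU n : measurable (U n) by apply: bigcup_measurable.
pose V := \bigcup_k window_core k W.
have mV : measurable V by apply: bigcupT_measurable.
have [n] : exists n, (q (V `\` U n) < e%:E)%E.
  apply: (@measure_small _ _ _ q (fun n => V `\` U n)) => //.
  - exact: (le_lt_trans (probability_le1 q measurableT) (ltry 1)).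
  - by move=> n; exact: measurableD.
  - move=> n m nm; apply/subsetPset => x [Vx Um]; split => //; apply: contra_not Um.
    by move=> -[i /= im Fi]; exists i => //=; exact: leq_trans nm.
  - apply/seteqP; split => // x H; have [[i _ Fi] _] := H 0%N I.
    have [_] := H i.+1 I; apply; by exists i => /=.
move=> Vn; exists n, (U n); split => //.
- move=> x y xy [k kn kx]; exists k => //.
  apply: (depends_onS _ (@depends_on_window_core k W)) kx; last exact: xy.
  by apply: box_subset; exact: ltnW.
- apply: measure_negligible; first exact: measurableD.
  apply: (@negligibleS _ _ _ _ (\bigcup_k (window_core k W `\` W))).
    by move=> x [[k _ kx] nW]; exists k.
  apply: negligible_bigcup => k; apply/negligibleP; first exact: measurableD.
  exact: window_core_setD.
- apply: le_lt_trans Vn.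
  have nul : q (W `\` V) = 0%E.
    apply: measure_negligible; first exact: measurableD.
    pose Z := \bigcup_k (window_core k W `|` window_core k (~` W)).
    have mZ : measurable Z by apply: bigcupT_measurable => k; exact: measurableU.
    apply: (@negligibleS _ _ _ _ (~` Z `|`
       \bigcup_k (window_core k (~` W) `\` ~` W))).
      move=> x [Wx nVx]; have [[k _ [kx|kx]]|] := pselect (Z x).
      - by exfalso; apply: nVx; exists k.
      - by right; exists k => //; split => //; apply.
      - by left.
    apply: negligibleU.
      apply/negligibleP; first exact: measurableC.
      by rewrite [LHS](probability_setC q mZ) full subee.
    apply: negligible_bigcup => k; apply/negligibleP; first exact: measurableD.
    exact: window_core_setD.
  rewrite -[leRHS]adde0 -nul.
  apply: le_trans (measureU2 _ _ _); try exact: measurableD.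
  apply: le_measure; rewrite ?inE; [exact: measurableD| |].
    by apply: measurableU; exact: measurableD.
  by move=> x /= [Wx Ux]; have [Vx|Vx] := pselect (V x); tauto.
Qed.

End inner_windows.

(** * Exponential concentration for finitary codings *)

Section law_of_field.
Context (d : nat) (R : realType) (dO : measure_display) (O : measurableType dO)
  (P : probability O R) (dT : measure_display) (T : measurableType dT).

Lemma measurable_sample (X : random_field d P T) :
  measurable_fun setT (sample X).
Proof. by apply: measurable_config => v; exact: measurable_funPT. Qed.

HB.instance Definition _ (X : random_field d P T) :=
  isMeasurableFun.Build _ _ _ _ (sample X) (measurable_sample X).

Definition law (X : random_field d P T) : probability (config d T) R :=
  distribution P (sample X).

Lemma lawE X A : law X A = P (sample X @^-1` A).
Proof. by []. Qed.

Lemma iid_product_law (X : random_field d P T) :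
  iid X -> product_law (distribution P (X 0)) (law X).
Proof.
move=> [sameX indX] V A mA.
rewrite [LHS](_ : _ = P (\bigcap_(v in [set` V]) X v @^-1` A v)); last first.
  rewrite -[LHS]/(P (sample X @^-1` rectangle V A)).
  by congr (P _); apply/seteqP; split => w H v; exact: H.
rewrite indX //; apply: eq_bigr => v _.
exact: sameX.
Qed.

End law_of_field.

Section codings.
Context (d : nat) (S : pointedType) (R : realType).
Context (dT : measure_display) (T : measurableType dT).
Context (dQ : measure_display) (O' : measurableType dQ) (Q : probability O' R).
Context (Y : random_field d Q T).
Context (phi : config d T -> config d (discrete S)).
Hypothesis iidY : iid Y.
Hypothesis mphi : measurable_fun setT phi.
Hypothesis shiftphi : forall u y, phi (shift u y) = shift u (phi y).
Hypothesis finphi : finitary Y phi.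

Let q := law Y.
Let pq : product_law (distribution Q (Y 0)) q := iid_product_law iidY.

Lemma measurable_phi A : measurable A -> measurable (phi @^-1` A).
Proof. by move=> mA; rewrite -[X in measurable X]setTI; exact: mphi. Qed.

Lemma discrete_measurableT (A : set (discrete S)) : measurable A.
Proof. exact: sub_sigma_algebra. Qed.

(** A finite coding radius at the origin determines the value there from a
    finite window, hence puts the configuration in a core.  The null set of the
    finitary hypothesis lives on the sample space and need not come from a
    measurable set of configurations, so nothing could be said about its
    translates; passing to the cores, which are measurable sets of
    configurations, makes the property one of the law of [Y], to which
    translations can be applied. *)
Lemma finitary_cores (W : set (config d T)) : measurable W ->
  (forall y y', phi y 0 = phi y' 0 -> W y -> W y') ->
  q (\bigcup_k (window_core q k W `|` window_core q k (~` W))) = 1%E.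
Proof.
move=> mW Wphi; pose Z k := window_core q k W `|` window_core q k (~` W).
have mZ : measurable (\bigcup_k Z k).
  apply: bigcupT_measurable => k.
  by apply: measurableU; apply: measurable_window_core => //; exact: measurableC.
have nulZ : q (~` (\bigcup_k Z k)) = 0%E.
  rewrite /q lawE; apply: measure_negligible.
    rewrite -[X in measurable X]setTI; apply: measurable_sample => //.
    exact: measurableC.
  apply: negligibleS finphi => w /= nZ fin_radius; apply: nZ.
  have [r rP] : exists r : nat, forall y' : config d T,
      (forall v, l1ball d r v -> y' v = sample Y w v) ->
      phi y' 0 = phi (sample Y w) 0.
    apply: contrapT => /forallNP none; move: fin_radius.
    rewrite /coding_radius (_ : [set _ | _ in _] = set0) ?ereal_inf0 ?ltxx //.
    by apply/seteqP; split => // x [r /= rP _]; exact: (none r).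
  exists r => //; have [Ww|nWw] := pselect (W (sample Y w)); [left|right];
    apply: window_core_forced => y' yy'.
    apply: Wphi Ww; apply/esym; apply: rP => v /l1ball_box; exact: yy'.
  apply: contra_not nWw; apply: Wphi; apply: rP => v /l1ball_box; exact: yy'.
have := probability_setC q mZ; rewrite nulZ -(fineK (fin_num_measure q _ mZ)).
rewrite -EFinB => -[] /eqP; rewrite eq_sym subr_eq0 => /eqP H.
by rewrite -[RHS]/((1 : R)%:E) [X in _ = X%:E]H fineK // fin_num_measure.
Qed.

Lemma ess_open_origin (A : set (discrete S)) :
  ess_open q [set y | A (phi y 0)].
Proof.
have mA : measurable [set y | A (phi y 0)].
  apply: (@measurable_phi ((fun x : config d (discrete S) => x 0) @^-1` A)).
  rewrite -[X in measurable X]setTI; apply: measurable_coord => //.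
  exact: discrete_measurableT.
by apply: (ess_open_forced pq) => //; apply: finitary_cores => // y y' /= ->.
Qed.

(** Carrying both [B] and its complement lets complements pass through the
    induction, as [ess_open] alone is not stable under them. *)
Lemma ess_open_local (B : set (config d (discrete S))) : local_event B ->
  ess_open q (phi @^-1` B) /\ ess_open q (phi @^-1` (~` B)).
Proof.
have coord v A : ess_open q (phi @^-1` ((fun x => x v) @^-1` A)).
  have -> : phi @^-1` ((fun x => x v) @^-1` A) =
      shift v @^-1` [set y | A (phi y 0)].
    by apply/seteqP; split => y /=; rewrite shiftphi /Defs.shift add0r.
  by apply: (ess_open_shift pq); exact: ess_open_origin.
elim=> [v A mA|C _ [oC oCC]|C D _ [oC oCC] _ [oD oDC]].
- split; first exact: coord.
  exact: (coord v (~` A)).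
- by split => //; rewrite setCK.
- split; first by rewrite preimage_setU; exact: ess_openU.
  by rewrite setCU preimage_setI; exact: ess_openI.
Qed.

Context (dO : measure_display) (O : measurableType dO) (P : probability O R).
Context (X : random_field d P (discrete S)).
Hypothesis lawphi : same_law Q (phi \o sample Y) P (sample X).

Lemma law_coding A : measurable A -> law X A = q (phi @^-1` A).
Proof. by move=> mA; rewrite lawE -[LHS]/(pushforward P (sample X) A) -lawphi. Qed.

(** Replace [phi @^-1` B] by a window event [H] inside it, up to null sets.
    Where [B] fails for the coded field, [H] fails for the i.i.d. field, and
    failures of [H] at distant sites are independent. *)
Lemma coding_concentration (B : set (config d (discrete S))) (rho : R) :
  local_event B -> 0 <= rho -> rho <= 1 ->
  (law X (~` B) < (rho ^+ 2)%:E)%E ->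
  exists m, forall (I : finType) (pos : I -> 'rV[int]_d), injective pos ->
    spread_out m [seq pos i | i <- enum I] ->
    (law X (many_shifts (~` B) pos) <= ((2 * rho) ^+ #|I|)%:E)%E.
Proof.
move=> lB rho0 rho1 PB.
have mB := measurable_local_event lB.
have mBC := measurableC mB.
have [[mW oW] _] := ess_open_local lB.
pose W := phi @^-1` B.
have mWC : measurable (~` W) by exact: measurableC.
rewrite law_coding // -[phi @^-1` _]/(~` W) in PB.
have finW : q (~` W) \is a fin_num by exact: fin_num_measure.
(* The strict inequality leaves room for the loss from W to H. *)
have gap : 0 < rho ^+ 2 - fine (q (~` W)).
  by rewrite subr_gt0 -lte_fin fineK.
have [m [H [mH Hm HW WH]]] := oW _ gap.
have mHC := measurableC mH.
have qH : (q (~` H) <= (rho ^+ 2)%:E)%E.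
  apply: (@le_trans _ _ (q (~` W `|` (W `\` H)))).
    apply: le_measure; rewrite ?inE // /W.
      by apply: measurableU => //; exact: measurableD.
    by move=> x nH; have [?|?] := pselect (W x); [right|left].
  apply: le_trans (measureU2 _ _ _) _ => //; first exact: measurableD.
  have := leeD (lexx (q (~` W))) (ltW WH).
  by rewrite EFinB fineK // [X in (_ <= X)%E]addeC subeK.
exists m => I pos injpos sep.
have mM : measurable (many_shifts (~` B) pos) by exact: measurable_many_shifts.
rewrite law_coding //.
have HmC := depends_onC Hm.
apply: le_trans (many_shifts_bound pq mHC HmC rho0 rho1 injpos sep qH).
have mM' : measurable (many_shifts (~` H) pos) by exact: measurable_many_shifts.
(* The null event that H occurs at some site without forcing B there. *)
pose N := \big[setU/set0]_(i : I) shift (pos i) @^-1` (H `\` W).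
have mHW : measurable (H `\` W) by exact: measurableD.
have mN : measurable N.
  by apply: bigsetU_measurable => i _; exact: measurable_shift_preimage.
have qN : q N = 0%E.
  apply/eqP; rewrite -measure_le0; apply: le_trans (measure_bigsetU_le_sum _ _ _) _.
    by move=> i; exact: measurable_shift_preimage.
  rewrite big1 // => i _; exact: etrans (shift_law pq (pos i) mHW) HW.
rewrite -[leRHS]adde0 -qN.
apply: le_trans (measureU2 _ _ _) => //.
apply: le_measure; rewrite ?inE; [exact: measurable_phi|exact: measurableU|].
move=> y My; have [Ny|nNy] := pselect (N y); [by right|left].
apply: leq_trans My _; rewrite leq_mul2l /=.
apply: subset_leq_card; apply/fintype.subsetP => i; rewrite !inE => nB.
move=> Hi; apply: nNy; rewrite /N -bigcup_pred; exists i => //.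
by split => //; rewrite /W /= shiftphi.
Qed.

End codings.

Lemma ffiid_concentration (d : nat) (S : pointedType) (R : realType)
    (dO : measure_display) (O : measurableType dO) (P : probability O R)
    (X : random_field d P (discrete S)) (B : set (config d (discrete S)))
    (rho : R) :
  ffiid X -> local_event B -> 0 <= rho -> rho <= 1 ->
  (law X (~` B) < (rho ^+ 2)%:E)%E ->
  exists m, forall (I : finType) (pos : I -> 'rV[int]_d), injective pos ->
    spread_out m [seq pos i | i <- enum I] ->
    (law X (many_shifts (~` B) pos) <= ((2 * rho) ^+ #|I|)%:E)%E.
Proof.
move=> [dT [T [dQ [U [Q [Y [phi [iidY [mphi sphi lphi] fphi]]]]]]]].
exact: (coding_concentration iidY mphi sphi fphi lphi).
Qed.

(** * Patterns on finite sets and the specification *)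

Lemma finite_functions (U : choiceType) (S : pointedType) :
  finite_set [set: U] -> finite_set [set: S] -> finite_set [set: U -> S].
Proof.
move=> /finite_seqP[sU hU] /finite_seqP[sS hS].
have inU u : u \in sU by have : [set: U] u by []; rewrite hU.
have inS a : a \in sS by have : [set: S] a by []; rewrite hS.
have [[u0 _]|noU] := pselect (exists u : U, True); last first.
  apply: (@sub_finite_set _ _ [set (fun=> point)]) (finite_set1 _) => f _.
  by apply/funext => u; exfalso; apply: noU; exists u.
pose g (h : {ffun 'I_(size sU).+1 -> 'I_(size sS).+1}) (u : U) : S :=
  nth point sS (h (inord (index u sU))).
apply: (@sub_finite_set _ _ (g @` setT)); last first.
  by apply: finite_image; exact: finite_finset.
move=> f _; exists [ffun i => inord (index (f (nth u0 sU (nat_of_ord i))) sS)] => //.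
apply/funext => u; rewrite /g ffunE.
by rewrite !inordK ?nth_index ?ltnS ?index_size.
Qed.

Lemma finite_box d n : finite_set (box d n).
Proof.
pose g (j : 'rV['I_(2 * n).+1]_d) : 'rV[int]_d :=
  \row_i (Posz (nat_of_ord (j ord0 i)) - n%:Z).
apply: (@sub_finite_set _ _ (g @` setT)); last first.
  by apply: finite_image; exact: finite_finset.
move=> v bv; exists (\row_i inord `|(v ord0 i + n%:Z)%R|%N) => //.
have entry (a : int) : (`|a| <= n)%N ->
    (`|(a + n%:Z)%R| < (2 * n).+1)%N /\ Posz `|(a + n%:Z)%R| - n%:Z = a by lia.
by apply/rowP => i; have [lt_n e] := entry _ (bv i); rewrite !mxE inordK.
Qed.

Lemma finite_set_box d (V : set 'rV[int]_d) : finite_set V ->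
  exists n, V `<=` box d n.
Proof.
move=> /finite_seqP[s ->]; exists (\sum_(v <- s) l1norm v)%N => v /= vs i.
apply: (@leq_trans (l1norm v)).
  by rewrite /l1norm (bigD1 i) //= leq_addr.
by rewrite (big_rem v) //= leq_addr.
Qed.

Lemma finite_boundary d (V : set 'rV[int]_d) : finite_set V ->
  finite_set (boundary V).
Proof.
move=> /finite_set_box[n Vn]; apply: (sub_finite_set _ (finite_box d (n + 1))).
move=> u [_ [v Vv uv]]; rewrite -(subrK v u) addrC.
apply: box_translate; first exact: Vn.
by apply: (@l1ball_box d 1); rewrite /l1ball /= uv.
Qed.

Section patterns.
Context (d : nat) (S : pointedType) (finS : finite_set [set: S]) (R : realType).
Context (dO : measure_display) (O : measurableType dO) (P : probability O R).
Context (X : random_field d P (discrete S)).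
Implicit Types (V : set 'rV[int]_d).

Lemma finite_patterns V (Z : set (V -> S)) : finite_set V -> finite_set Z.
Proof.
move=> finV; apply: (@sub_finite_set _ _ setT) => //.
apply: finite_functions => //.
by rewrite (eq_finite_set (card_setT V)).
Qed.

Lemma measurable_event1 V (tau : V -> S) : measurable (event X [set tau]).
Proof.
have -> : event X [set tau] = ~` \bigcup_(v : V) (X (val v) @^-1` (~` [set tau v])).
  apply/seteqP; split => w /=.
    by move=> e [v _] /=; apply; rewrite -e.
  move=> H; apply/funext => v; apply: contrapT => Hv; apply: H.
  by exists v.
apply: measurableC; apply: countable_bigcupT_measurable => [|v].
  exact: countableP.
by rewrite -[X in measurable X]setTI; apply: measurable_funPT => //;
  exact: discrete_measurableT.
Qed.

Lemma event_bigcup V (Z : set (V -> S)) :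
  event X Z = \bigcup_(tau in Z) event X [set tau].
Proof.
apply/seteqP; split => w; first by move=> Zw; exists (sigL V (sample X w)).
by move=> [tau Ztau e]; move: Ztau; rewrite -e.
Qed.

Lemma measurable_event V (Z : set (V -> S)) : finite_set V ->
  measurable (event X Z).
Proof.
move=> finV; rewrite event_bigcup.
apply: fin_bigcup_measurable; first exact: finite_patterns.
by move=> tau _; exact: measurable_event1.
Qed.

(** Summation over the finitely many patterns, as in the law of total
    probability. *)
Lemma event_sum_le V (Z : set (V -> S)) (G : set O) :
  finite_set V -> measurable G ->
  (forall tau, Z tau -> (P (event X [set tau]) <=
     2%:E * P (G `&` event X [set tau]))%E) ->
  (P (event X Z) <= 2%:E * P (G `&` event X Z))%E.
Proof.
move=> finV mG ZG; have finZ := finite_patterns Z finV.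
have triv : trivIset Z (fun tau : V -> S => event X [set tau]).
  by move=> s t _ _ [w [/= <- <-]].
rewrite event_bigcup setI_bigcupr !measure_fin_bigcup //.
- rewrite ge0_mule_fsumr; last by move=> tau; exact: measure_ge0.
  exact: lee_fsum.
- by move=> s t Zs Zt [w [[_ ws] [_ wt]]]; apply: triv => //; exists w.
- by move=> tau _; apply: measurableI => //; exact: measurable_event1.
- by move=> tau _; exact: measurable_event1.
Qed.

Lemma event_null V (Z : set (V -> S)) : finite_set V ->
  (forall tau, Z tau -> P (event X [set tau]) = 0%E) -> P (event X Z) = 0%E.
Proof.
move=> finV Z0; apply/eqP; rewrite -measure_le0.
apply: le_trans (@event_sum_le _ Z set0 finV measurable0 _) _.
  by move=> tau Ztau; rewrite set0I measure0 mule0 Z0.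
by rewrite set0I measure0 mule0.
Qed.

(** A configuration outside the support shows a null pattern on some finite
    set, hence on some box; there are countably many boxes, with finitely many
    patterns each. *)
Lemma support_full : P.-negligible (~` (sample X @^-1` Defs.support X)).
Proof.
pose Z n : set (box d n -> S) := [set b | P (event X [set b]) = 0%E].
apply: (@negligibleS _ _ _ _ (\bigcup_n event X (Z n))); last first.
  apply: negligible_bigcup => n; apply/negligibleP.
    by apply: measurable_event; exact: finite_box.
  by apply: event_null => //; exact: finite_box.
move=> w /= /existsNP[V /not_implyP[finV /negP]]; rewrite -leNgt => V0.
have [n Vn] := finite_set_box finV; exists n => //.
rewrite /event /Z /=; apply/eqP; rewrite -measure_le0; apply: le_trans V0.
apply: le_measure; rewrite ?inE; try exact: measurable_event1.
move=> z /= /eq_sigLP zw; apply/eq_sigLP => v /set_mem/Vn bv.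
by apply: zw; rewrite mem_set.
Qed.

Lemma event_outside_support V (tau : V -> S) :
  ~ support_on X V tau -> P (event X [set tau]) = 0%E.
Proof.
move=> ntau; apply: measure_negligible; first exact: measurable_event1.
apply: negligibleS support_full => w /= wtau sw; apply: ntau.
by exists (sample X w).
Qed.

Lemma pattern_event V (G : set (config d (discrete S))) : depends_on V G ->
  sample X @^-1` G = event X (sigL V @` G).
Proof.
move=> GV; apply/seteqP; split => w /=; first by exists (sample X w).
move=> [x Gx /eq_sigLP xw]; apply: GV Gx => v Vv.
by apply: xw; rewrite mem_set.
Qed.

End patterns.

Section specification_transfer.
Context (d : nat) (S : pointedType) (finS : finite_set [set: S]) (R : realType).
Context (dO : measure_display) (O : measurableType dO) (P : probability O R).
Context (dO' : measure_display) (O' : measurableType dO') (P' : probability O' R).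
Context (X : random_field d P (discrete S)) (X' : random_field d P' (discrete S)).
Hypothesis same_spec : same_specification X X'.

(** [Z] is the set of boundary conditions that give [G] conditional probability
    at least 1/2; the two fields agree on it since they share the specification.
    Under [X'] a boundary condition outside [Z] makes the complement of [G] at
    least as likely as not, and under [X] one inside [Z] makes [G] at least as
    likely as not; both inequalities follow by averaging over the boundary. *)
Lemma boundary_transfer (V : set 'rV[int]_d) (G : set (config d (discrete S))) :
  finite_set V -> measurable G -> depends_on V G ->
  exists Z : set (boundary V -> S), [/\ Z `<=` support_on X (boundary V),
    (P' (event X' (~` Z)) <= 2%:E * law X' (~` G))%E &
    (P (event X Z) <= 2%:E * law X G)%E].
Proof.
move=> finV mG GV; have finD := finite_boundary finV.
have [suppE specE] := same_spec finV.
pose A : set (V -> S) := sigL V @` G.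
pose Z : set (boundary V -> S) := [set tau | support_on X (boundary V) tau /\
  2^-1 <= specification X' tau A].
have mA : measurable (event X A) by exact: measurable_event.
have mA' : measurable (event X' A) by exact: measurable_event.
exists Z; split; first by move=> tau [].
- have -> : law X' (~` G) = P' (~` event X' A).
    by rewrite /A -(pattern_event X' GV).
  apply: (@le_trans _ _ (2%:E * P' (~` event X' A `&` event X' (~` Z)))%E).
    apply: event_sum_le => //; first exact: measurableC.
    move=> tau nZtau.
    have [supp|nsupp] := pselect (support_on X' (boundary V) tau); last first.
      by rewrite event_outside_support // mule_ge0.
    have {nZtau} : specification X' tau A < 2^-1.
      rewrite ltNge; apply/negP => H; apply: nZtau; split => //.
      by rewrite suppE.
    rewrite /specification /cond_prob.
    set C := event X' [set tau].
    have mC : measurable C by exact: measurable_event1.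
    have mAC : measurable (event X' A `&` C) by exact: measurableI.
    have mAnC : measurable (~` event X' A `&` C).
      by apply: measurableI => //; exact: measurableC.
    have split_C : P' C = (P' (event X' A `&` C) + P' (~` event X' A `&` C))%E.
      rewrite -measureU // -?setIUl ?setUv ?setTI //.
      by rewrite setIACA setICr set0I.
    rewrite split_C -(fineK (fin_num_measure P' _ mAC)).
    rewrite -(fineK (fin_num_measure P' _ mAnC)) -EFinD /= -EFinM lee_fin.
    have : 0 <= fine (P' (event X' A `&` C)) by exact: fine_ge0.
    have : 0 <= fine (P' (~` event X' A `&` C)) by exact: fine_ge0.
    move: (fine (P' (event X' A `&` C))) (fine (P' (~` event X' A `&` C))).
    move=> a b b0 a0.
    have [->|ab0] := eqVneq (a + b) 0; first by rewrite mulr_ge0.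
    rewrite ltr_pdivrMr; last by rewrite lt_neqAle eq_sym ab0 addr_ge0.
    move=> H; lra.
  apply: lee_wpmul2l => //; apply: le_measure; rewrite ?inE.
  + by apply: measurableI; [exact: measurableC|exact: measurable_event].
  + exact: measurableC.
  + by move=> w [].
- have -> : law X G = P (event X A) by rewrite /A -(pattern_event X GV).
  apply: (@le_trans _ _ (2%:E * P (event X A `&` event X Z))%E).
    apply: event_sum_le => // tau [supp].
    rewrite -(specE _ supp) /specification /cond_prob.
    set C := event X [set tau].
    have mC : measurable C by exact: measurable_event1.
    have mAC : measurable (event X A `&` C) by exact: measurableI.
    rewrite -(fineK (fin_num_measure P _ mAC)) -(fineK (fin_num_measure P _ mC)).
    rewrite /= -EFinM lee_fin.
    have : 0 <= fine (P C) by exact: fine_ge0.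
    have : 0 <= fine (P (event X A `&` C)) by exact: fine_ge0.
    move: (fine (P (event X A `&` C))) (fine (P C)) => a b a0 b0.
    have [->|ab0] := eqVneq b 0; first by rewrite mulr_ge0.
    rewrite ler_pdivlMr; last by rewrite lt_neqAle eq_sym ab0.
    move=> H; lra.
  apply: lee_wpmul2l => //; apply: le_measure; rewrite ?inE //.
  by apply: measurableI => //; exact: measurable_event.
Qed.

End specification_transfer.

(** * Comparison on a sparse grid *)

Section few_shifts.
Context (d : nat) (R : realType) (dT : measure_display) (T : measurableType dT).
Local Notation E := (config d T).

(** Markov's inequality for the number of translates of [B] that occur, whose
    expectation is [#|I|] times the probability of [B]. *)
Lemma few_shifts_bound (mu : probability E R) (B : set E) (I : finType)
    (pos : I -> 'rV[int]_d) : invariant_law mu -> measurable B ->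
  (mu (~` many_shifts (~` B) pos) <= 2%:E * mu B)%E.
Proof.
move=> inv mB.
pose Bi i := shift (pos i) @^-1` B.
have mBi i : measurable (Bi i) by exact: measurable_shift_preimage.
have mM : measurable (many_shifts (~` B) pos).
  by apply: measurable_many_shifts; exact: measurableC.
pose N : set E := ~` many_shifts (~` B) pos.
have mN : measurable N by exact: measurableC.
rewrite -/N.
have count (x : E) : N x ->
    (#|I| <= 2 * \sum_(i : I) (x \in Bi i))%N /\ (0 < #|I|)%N.
  move=> /negP; rewrite -ltnNge.
  set K := [set i | _]%SET => K2.
  have <- : (\sum_(i in ~: K) 1 = \sum_(i : I) (x \in Bi i))%N.
    rewrite big_mkcond /=; apply: eq_bigr => i _; rewrite !inE.
    have [Bx|nBx] := pselect (B (shift (pos i) x)).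
      rewrite (_ : `[< _ >] = false) ?mem_set //.
      by apply/negbTE/asboolPn; apply.
    by rewrite (_ : `[< _ >] = true) ?memNset //; apply/asboolP.
  rewrite sum1_card; have := cardsC K; lia.
(* Without any index, many_shifts is the sure event. *)
have [I0|I0] := posnP #|I|.
  rewrite [X in mu X](_ : _ = set0) ?measure0 ?mule_ge0 //.
  by apply/seteqP; split => // x /count[_]; rewrite I0.
pose f i x : \bar R := (\1_(Bi i) x)%:E.
have finB : mu B \is a fin_num by exact: fin_num_measure.
have key : (#|I|%:R%:E * mu N <= 2%:E * (#|I|%:R%:E * mu B))%E.
  have mf i : measurable_fun N (f i).
    by apply: measurable_funTS; apply/measurable_EFinP; exact: measurable_indic.
  have f0 i x : N x -> (0 <= f i x)%E by rewrite lee_fin.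
  rewrite -(integral_cst mu mN).
  apply: (@le_trans _ _ (\int[mu]_(x in N) (2%:E * \sum_(i : I) f i x))%E).
    apply: ge0_le_integral => //.
    - by move=> x _; rewrite /= lee_fin.
    - by apply: measurable_funeM; exact: emeasurable_sum.
    - move=> x /count[le2 _]; rewrite /f sumEFin -EFinM lee_fin.
      under eq_bigr do rewrite indicE.
      by rewrite -natr_sum -natrM ler_nat.
  rewrite ge0_integralZl //; last 2 first.
  - exact: emeasurable_sum.
  - by move=> x Nx; apply: sume_ge0 => i _; exact: f0.
  rewrite lee_wpmul2l // ge0_integral_sum //.
  have -> : (#|I|%:R%:E * mu B = \sum_(i : I) mu B)%E.
    by rewrite -(fineK finB) sumEFin sumr_const -EFinM mulr_natl.
  apply: lee_sum => i _.
  rewrite /f integral_indic // -(inv (pos i) B mB).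
  apply: le_measure; rewrite ?inE; [|exact: mBi|exact: subIsetl].
  by apply: measurableI => //; exact: mBi.
move: key; rewrite muleCA.
by rewrite lee_pmul2l // lte_fin ltr0n.
Qed.

End few_shifts.

Section grid.
Context (d : nat).

Definition grid (L N : nat) (j : 'rV['I_N]_d) : 'rV[int]_d :=
  \row_i (L * nat_of_ord (j ord0 i))%N%:Z.

Lemma card_grid N : #|{: 'rV['I_N]_d}| = (N ^ d)%N.
Proof. by rewrite card_mx card_ord mul1n. Qed.

Lemma grid_inj L N : (0 < L)%N -> injective (@grid L N).
Proof.
move=> L0 j k /rowP jk; apply/rowP => i; have := jk i; rewrite !mxE => -[].
by move=> /eqP; rewrite eqn_pmul2l // => /eqP /val_inj.
Qed.

Lemma grid_spread_out m L N : (2 * m < L)%N ->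
  spread_out m [seq grid L j | j <- enum {: 'rV['I_N]_d}].
Proof.
move=> mL _ _ w /mapP[j _ ->] /mapP[k _ ->] jk wj wk.
have apart (x : int) (a b : nat) : (`|(x - (L * a)%N%:Z)%R| <= m)%N ->
    (`|(x - (L * b)%N%:Z)%R| <= m)%N -> ~ (a < b)%N.
  move=> xa xb ab; have : (L * a + L <= L * b)%N by rewrite -mulnSr leq_mul.
  lia.
move/eqP: jk; apply; apply/rowP => i; rewrite !mxE; congr (Posz (L * _)).
have := wj i; have := wk i; rewrite !mxE => wki wji.
case: (ltngtP (nat_of_ord (j ord0 i)) (nat_of_ord (k ord0 i))) => // lt_jk.
  by case: (apart _ _ _ wji wki lt_jk).
by case: (apart _ _ _ wki wji lt_jk).
Qed.

Lemma grid_box r L N n (v : 'rV[int]_d) (j : 'rV['I_N]_d) :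
  (r + L * N <= n)%N -> box d r v -> box d n (v + grid L j).
Proof.
move=> rn rv i; rewrite !mxE; have := rv i.
have jN : (L * nat_of_ord (j ord0 i) <= L * N)%N by rewrite leq_mul // ltnW.
by move: (v ord0 i) (L * _)%N jN => x y; lia.
Qed.

Lemma depends_on_many_shifts (dT : measure_display) (T : measurableType dT)
    (C : set (config d T)) r n (I : finType) (pos : I -> 'rV[int]_d) :
  (forall i v, box d r v -> box d n (v + pos i)) -> depends_on (box d r) C ->
  depends_on (box d n) (many_shifts C pos).
Proof.
move=> posn Cr x y xy; rewrite /many_shifts /=.
suff -> : [set i | `[< C (shift (pos i) x) >]]%SET =
          [set i | `[< C (shift (pos i) y) >]]%SET by [].
apply/setP => i; rewrite !inE; apply: asbool_equiv_eq; split; apply: Cr => v rv;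
  by rewrite /Defs.shift xy //; exact: posn.
Qed.

End grid.

(** The ratio of the two sides grows exponentially in the volume, and
    [1 + t <= expR t] already makes it exceed 2. *)
Lemma exp_volume_gap (R : realType) (d : nat) (K : R) : (0 < d)%N -> 0 < K ->
  exists M, forall n, (M <= n)%N ->
    2 * expR (- (K * n%:R ^+ d)) < expR (- (K / 2 * n%:R ^+ d)).
Proof.
move=> d0 K0; have K2 : 0 <= 2 / K by rewrite divr_ge0 // ltW.
exists (Num.bound (2 / K)).+1 => n Mn.
have n_gt : 2 / K < n%:R.
  apply: lt_le_trans (archi_boundP K2) _.
  by rewrite ler_nat ltnW.
have n_le : n%:R <= n%:R ^+ d :> R.
  have n1 : 1 <= n%:R :> R by rewrite ler1n; lia.
  by rewrite -[X in X <= _]expr1 ler_weXn2l.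
set a := n%:R ^+ d in n_le *.
have Ka : 2 < K * a.
  by rewrite mulrC -ltr_pdivrMr //; exact: lt_le_trans n_le.
have -> : - (K / 2 * a) = K / 2 * a + - (K * a) by lra.
rewrite expRD ltr_pM2r ?expR_gt0 //.
apply: lt_le_trans (expR_ge1Dx _); lra.
Qed.

Lemma ergodic_invariant_law (d : nat) (R : realType) (dO : measure_display)
    (O : measurableType dO) (P : probability O R) (dT : measure_display)
    (T : measurableType dT) (X : random_field d P T) :
  ergodic X -> invariant_law (law X).
Proof. by move=> [inv _] u A mA; exact: (inv u A mA). Qed.

Lemma ergodic_zero_one_law (d : nat) (R : realType) (dO : measure_display)
    (O : measurableType dO) (P : probability O R) (dT : measure_display)
    (T : measurableType dT) (X : random_field d P T) :
  ergodic X -> zero_one_law (law X).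
Proof. by move=> [_ zo] A mA iA; exact: (zo A mA iA). Qed.

(** The set of boundary conditions given by [boundary_transfer], for the event
    that [B] fails at half of the sites of a grid or more, competes in the
    infimum: it is likely for [X'] and exponentially unlikely for [X]. *)
Lemma ffiid_boundary_decay (R : realType) (d : nat) (S : pointedType)
    (finS : finite_set [set: S])
    (dO dO' : measure_display) (O : measurableType dO) (O' : measurableType dO')
    (P : probability O R) (P' : probability O' R)
    (X : random_field d P (discrete S)) (X' : random_field d P' (discrete S))
    (eps : R) :
  ergodic X -> ergodic X' -> ~ same_law P (sample X) P' (sample X') ->
  same_specification X X' -> 0 < eps -> ffiid X ->
  exists2 K : R, 0 < K & \forall n \near \oo,
    (boundary_inf X X' eps n <= (2 * expR (- (K * n%:R ^+ d)))%:E)%E.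
Proof.
move=> ergX ergX' neq_law same_spec eps0 ffX.
(* With this rho, the bound (2 rho) ^ |I| of the concentration is e ^ (- |I|). *)
pose rho : R := expR (- 1) / 2.
have rho0 : 0 < rho by rewrite divr_gt0 // expR_gt0.
have rho1 : rho <= 1.
  rewrite /rho ler_pdivrMr // mul1r; apply: le_trans (_ : 1 <= _); last by lra.
  by rewrite expR_le1 lerN10.
(* The first bound feeds the concentration for X.  In the second, the factor 4
   pays for Markov's inequality and for the passage to the boundary. *)
pose e : R := Num.min (rho ^+ 2) (eps / 4).
have e0 : 0 < e by rewrite lt_min exprn_gt0 //= divr_gt0.
have neq : exists2 A, measurable A & law X A <> law X' A.
  apply: contrapT => H; apply: neq_law => A mA; apply: contrapT => HA.
  by apply: H; exists A.
have [B [lB XB X'B]] := local_separation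
  (ergodic_invariant_law ergX) (ergodic_invariant_law ergX')
  (ergodic_zero_one_law ergX) (ergodic_zero_one_law ergX') neq e0.
have mB := measurable_local_event lB.
have [r Br] := local_event_box lB.
have [m conc] : exists m, forall (I : finType) (pos : I -> 'rV[int]_d),
    injective pos -> spread_out m [seq pos i | i <- enum I] ->
    (law X (many_shifts (~` B) pos) <= ((2 * rho) ^+ #|I|)%:E)%E.
  apply: ffiid_concentration => //; first exact: ltW.
  by apply: lt_le_trans XB _; rewrite lee_fin ge_min lexx.
(* The least spacing for which boxes of radius m at distinct sites of the grid
   are disjoint. *)
pose L := (2 * m).+1.
exists ((2 * L)%:R ^- d); first by rewrite invr_gt0 exprn_gt0 // ltr0n.
exists (2 * (r + L))%N => // n /= nbig.
(* The grid and the boxes of radius r around its sites fit in the box of radius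
   n, and for large n there are at least n / 2L sites in each direction. *)
pose N := ((n - r) %/ L)%N.
have LN : (r + L * N <= n)%N.
  have := leq_trunc_div (n - r) L; rewrite -/N mulnC; lia.
have nN : (n <= 2 * L * N)%N.
  have := ltn_ceil (n - r) (isT : 0 < L)%N; rewrite -/N; nia.
pose pos := @grid d L N.
pose G := many_shifts (~` B) pos.
have mG : measurable G by apply: measurable_many_shifts; exact: measurableC.
have Gn : depends_on (box d n) G.
  apply: (@depends_on_many_shifts _ _ _ _ r) => [j v|]; first exact: grid_box.
  exact: depends_onC.
have [Z [Zsupp PZ' PZ]] := boundary_transfer finS same_spec (finite_box d n) mG Gn.
have mZ : measurable (event X' Z).
  by apply: measurable_event => //; exact: finite_boundary (finite_box d n).
apply: (@le_trans _ _ (P (event X Z))).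
  apply: ereal_inf_lbound; exists Z => //; split => //.
  have ZC : event X' (~` Z) = ~` event X' Z by [].
  have : (P' (~` event X' Z) <= eps%:E)%E.
    rewrite -ZC; apply: le_trans PZ' _.
    apply: (@le_trans _ _ (2%:E * (2%:E * law X' B))%E).
      rewrite lee_wpmul2l //; apply: few_shifts_bound => //.
      exact: ergodic_invariant_law.
    rewrite muleA -EFinM.
    apply: (@le_trans _ _ ((2 * 2)%:E * (eps / 4)%:E)%E); last first.
      by rewrite -EFinM lee_fin; lra.
    rewrite lee_wpmul2l //; apply: ltW; apply: lt_le_trans X'B _.
    by rewrite lee_fin ge_min lexx orbT.
  rewrite probability_setC // -(fineK (fin_num_measure P' _ mZ)).
  rewrite -EFinB !lee_fin; lra.
apply: le_trans PZ _; rewrite EFinM lee_wpmul2l //.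
apply: le_trans (conc _ pos _ _) _; first exact: grid_inj.
  exact: grid_spread_out.
rewrite lee_fin card_grid /rho mulrC divfK // -expRM_natl.
rewrite ler_expR mulrN1 lerN2 natrX mulrC -expr_div_n.
apply: lerXn2r; rewrite ?nnegrE ?divr_ge0 //.
by rewrite ler_pdivrMr ?ltr0n // -natrM ler_nat mulnC.
Qed.

Theorem theorem1p3 (R : realType) (d : nat) (hd : (0 < d)%N)
    (S : pointedType) (finS : finite_set [set: S])
    (dO dO' : measure_display) (O : measurableType dO) (O' : measurableType dO')
    (P : probability O R) (P' : probability O' R)
    (X : random_field d P (discrete S)) (X' : random_field d P' (discrete S))
    (ergX : ergodic X) (ergX' : ergodic X')
    (mrfX : markov_random_field X) (mrfX' : markov_random_field X')
    (neq_law : ~ same_law P (sample X) P' (sample X'))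
    (same_spec : same_specification X X')
    (inf_lb : exists2 eps : R, 0 < eps &
      exists2 f : nat -> R^o,
        f =o_\oo (fun n => n%:R ^+ d : R^o) &
        \forall n \near \oo,
          ((expR (- f n))%:E <= boundary_inf X X' eps n)%E) :
  ~ ffiid X.
Proof.
move=> ffX; case: inf_lb => eps eps0 [f fo f_lb].
have [K K0 decay] := ffiid_boundary_decay finS ergX ergX' neq_law same_spec eps0 ffX.
have [M gap] := exp_volume_gap hd K0.
have K20 : 0 < K / 2 by rewrite divr_gt0.
have f_small : \forall n \near \oo, `|f n| <= K / 2 * `|n%:R ^+ d : R^o|.
  by move: fo => /eqoP/(_ _ K20).
near \oo => n.
have : ((expR (- f n))%:E <= (2 * expR (- (K * n%:R ^+ d)))%:E)%E.
  by apply: (@le_trans _ _ (boundary_inf X X' eps n)); near: n.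
rewrite lee_fin leNgt => /negP; apply.
apply: lt_le_trans (gap n _) _; first by near: n; exists M.
rewrite ler_expR lerN2; apply: le_trans (ler_norm _) _.
have nd0 : 0 <= n%:R ^+ d :> R by rewrite exprn_ge0.
rewrite -[X in _ * X](ger0_norm nd0); near: n; exact: f_small.
Unshelve. all: by end_near. Qed.
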